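(* Every dyadic space is selectively sequentially pseudocompact. In particular, every compact topological group is selectively sequentially pseudocompact.
   Context: All topological spaces are assumed to be Tychonoff (in particular Hausdorff) and all topological groups Hausdorff. A space is dyadic if it is a continuous image of the Cantor cube $\{0,1\}^\tau$ for some cardinal $\tau$ (where $\{0,1\}$ is discrete and the product has the Tychonoff topology). A topological space $X$ is called selectively sequentially pseudocompact if for every sequence $\{U_n:n\in\mathbb{N}\}$ of non-empty open subsets of $X$ one can choose a point $x_n\in U_n$ for every $n\in\mathbb{N}$ in such a way that the sequence $\{x_n:n\in\mathbb{N}\}$ has a subsequence converging to some point of $X$. *)

(* Defs.v *)
From HB Require Import structures.
From mathcomp Require Import all_boot all_order all_algebra.
From mathcomp Require Import all_classical all_reals all_analysis.

Set Implicit Arguments.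
Unset Strict Implicit.
Unset Printing Implicit Defensive.

Local Open Scope classical_set_scope.

(* Tychonoff spaces: complete regularity alone does not imply Hausdorff. *)
Definition tychonoff_space (X : topologicalType) : Prop :=
  hausdorff_space X /\ completely_regular_space X.

(* The exponent of the Cantor cube is an arbitrary type I (possibly empty);
   the topology of bool is discrete and that of {ptws I -> bool} is the
   product topology. *)
Definition dyadic_space (X : topologicalType) : Prop :=
  exists (I : Type) (f : {ptws I -> bool} -> X),
    continuous f /\ range f = [set: X].

Definition selectively_sequentially_pseudocompact (X : topologicalType) :
    Prop :=
  forall U : nat -> set X,
    (forall n, open (U n)) -> (forall n, U n !=set0) ->
    exists2 x : nat -> X, (forall n, U n (x n)) &
      exists (k : nat -> nat) (l : X),
        increasing_seq k /\ (x \o k) @ \oo --> l.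

(* Multiplicative, possibly non-commutative analogue of topologicalZmodType. *)
HB.mixin Record PreTopologicalGroup_isTopologicalGroup G
    & Topological G & monoid.Group G := {
  mulg_continuous : continuous (fun x : G * G => (x.1 * x.2)%g) ;
  invg_continuous : continuous (fun x : G => (x^-1)%g)
}.

#[short(type="topologicalGroupType")]
HB.structure Definition TopologicalGroup :=
  {G of Topological G & monoid.Group G
        & PreTopologicalGroup_isTopologicalGroup G}.

(* Main.v *)
(* Dyadicity of compact groups is not needed: the group statement is proved
   directly, and dyadic spaces follow because the Cantor cube is itself a compact
   group and the property passes to continuous images.
   In a compact group G, given g_n in U_n, the intersection N of a suitable
   sequence of neighbourhoods of 1 is a closed subgroup with g_n N inside U_n,
   and G/N is first countable, so after passing to a subsequence and translating,
   the cosets g_n N converge to the point N of G/N.  It remains to lift this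
   convergence to G.  By Zorn's lemma take a minimal closed subgroup N together
   with convergent cosets x_n N inside the initial ones.  If N <> {1}, some
   smaller closed subgroup K of N is a relative G_delta, K = N `&` \bigcap_n V n.
   As G -> G/N is open, one may choose x'_n in x_n N that eventually lies in each
   V m, and then compactness forces x'_n K to converge to K, contradicting
   minimality.  Hence N = {1} and the points x_n converge. *)
From HB Require Import structures.
Require Import Defs.
From mathcomp Require Import all_boot all_order all_algebra.
From mathcomp Require Import all_classical all_reals all_analysis.

Set Implicit Arguments.
Unset Strict Implicit.
Unset Printing Implicit Defensive.

Local Open Scope classical_set_scope.

(** * Compactness for chains of closed sets, and subsequences *)

Lemma compact_chain_sub (T : topologicalType) (I : Type) (A : set I)
    (C : I -> set T) (W : set T) :
  compact [set: T] -> A !=set0 -> (forall i, A i -> closed (C i)) ->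
  total_on A (fun i j => C i `<=` C j) -> open W ->
  \bigcap_(i in A) C i `<=` W -> exists2 i, A i & C i `<=` W.
Proof.
move=> cT [i0 Ai0] clC totC oW CW; apply: contrapT => noC.
(* If no [C i] lies in [W], these differences form a chain of nonempty closed sets; a cluster point
   of the filter they generate belongs to all of them, hence to every [C i] but not to [W]. *)
pose B i := C i `&` ~` W.
have B0 i : A i -> B i !=set0.
  move=> Ai; apply: contrapT => /set0P/negP/negPn/eqP Bi0; apply: noC.
  by exists i => // x Cx; apply: contrapT => Wx; have : set0 x by rewrite -Bi0.
have FB : Filter (filter_from A B).
  apply: filter_from_filter; first by exists i0.
  move=> i j Ai Aj; have [ij|ji] := totC i j Ai Aj.
    by exists i => // x [Cx Wx]; split; split=> //; exact: ij.
  by exists j => // x [Cx Wx]; split; split=> //; exact: ji.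
have PB : ProperFilter (filter_from A B) by exact: filter_from_proper.
have [|p [_ clp]] := cT _ PB; first exact: filterT.
have Bp i : A i -> B i p.
  move=> Ai; have clB : closed (B i).
    by apply: closedI; [exact: clC|exact: open_closedC].
  by apply: clB; move: clp; rewrite clusterE; apply; exists i.
by have [_] := Bp _ Ai0; apply; apply: CW => i /Bp[].
Qed.

Lemma strictly_increasing_selection (P : nat -> nat -> Prop) :
  (forall m N, exists2 n, (N <= n)%N & P m n) ->
  exists2 k : nat -> nat, increasing_seq k & forall j, P j (k j).
Proof.
move=> hP.
have /choice[f hf] (mN : nat * nat) : exists n, (mN.2 <= n)%N /\ P mN.1 n.
  by case: mN => m N; have [n] := hP m N; exists n.
pose k := fix k j := if j is j'.+1 then f (j, (k j').+1) else f (0, 0)%N.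
exists k; last first.
  by case=> [|j]; [exact: (hf (0, 0)%N).2|exact: (hf (j.+1, (k j).+1)).2].
by apply/increasing_seqP => j; have [] := hf (j.+1, (k j).+1).
Qed.

Lemma increasing_seq_cvg (k : nat -> nat) : increasing_seq k -> k @ \oo --> \oo.
Proof.
move=> /increasing_seqP kS.
have kge j : (j <= k j)%N by elim: j => // j /leq_ltn_trans; apply; exact: kS.
move=> A [N _ NA]; exists N => // j /= Nj; apply: NA => /=.
exact: leq_trans (kge j).
Qed.

(** * Neighbourhoods of the identity in a topological group *)

Section TopologicalGroup.
Context {G : topologicalGroupType}.
Implicit Types (x y z : G) (N W : set G).
Local Open Scope group_scope.

Lemma mulg_cvg (T : Type) (Phi : set_system T) (f g : T -> G) x y :
  Filter Phi -> f @ Phi --> x -> g @ Phi --> y ->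
  (fun t => f t * g t) @ Phi --> x * y.
Proof.
move=> FPhi fx gy.
have fgxy : (fun t => (f t, g t)) @ Phi --> (x, y) by exact: cvg_pair.
exact: cvg_comp fgxy (mulg_continuous (x, y)).
Qed.

Lemma mulg_continuousl x : continuous (fun y => x * y).
Proof. by move=> y; apply: mulg_cvg; [exact: cvg_cst|exact: cvg_id]. Qed.

Lemma mulg_continuousr x : continuous (fun y => y * x).
Proof. by move=> y; apply: mulg_cvg; [exact: cvg_id|exact: cvg_cst]. Qed.

Definition subgroup_set N := N 1 /\ forall x y, N x -> N y -> N (x^-1 * y).

Lemma subgroup_setV N x : subgroup_set N -> N x -> N x^-1.
Proof. by move=> [N1 NV] Nx; rewrite -[x^-1]mulg1; exact: NV. Qed.

Lemma subgroup_setM N x y : subgroup_set N -> N x -> N y -> N (x * y).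
Proof.
by move=> sN Nx Ny; rewrite -[x]invgK; apply: sN.2 => //; exact: subgroup_setV.
Qed.

Lemma nbhs1_div W : nbhs (1 : G) W -> exists V, [/\ open V, V 1 &
  forall x y, V x -> V y -> W (x^-1 * y)].
Proof.
move=> W1.
have : (fun p : G * G => p.1^-1 * p.2) @ nbhs ((1, 1) : G * G) --> (1 : G).
  rewrite -[X in _ --> X](mulVg 1); apply: mulg_cvg; last exact: cvg_snd.
  by apply: (cvg_comp fst (fun z => z^-1)); [exact: cvg_fst|exact: invg_continuous].
move=> /(_ _ W1) [[A B] /= [A1 B1] AB].
exists (A `&` B)^°; split; [exact: open_interior|exact: filterI|].
by move=> x y /interior_subset[Ax _] /interior_subset[_ By]; exact: (AB (x, y)).
Qed.

(** The division condition makes the intersection of the [V n] a closed subgroup, without asking for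
    symmetric sets. *)
Definition nested_nbhs1 (V : nat -> set G) :=
  [/\ forall n, open (V n), forall n, V n 1 &
      forall n x y, V n.+1 x -> V n.+1 y -> V n (x^-1 * y)].

Lemma nested_nbhs1_exists (W : nat -> set G) :
  (forall n, nbhs (1 : G) (W n)) ->
  exists2 V, nested_nbhs1 V & forall n, V n `<=` W n.
Proof.
move=> W1.
(* The hypothesis sits inside the existential so that [d] is a total function, which the recursion
   below can iterate. *)
have /choice[d hd] (U : set G) : exists V, nbhs (1 : G) U ->
    [/\ open V, V 1 & forall x y, V x -> V y -> U (x^-1 * y)].
  have [/nbhs1_div[V]|nU] := pselect (nbhs (1 : G) U); first by exists V.
  by exists setT.
pose V := fix V n :=
  if n is m.+1 then d (V m) `&` (W n)^° else (W 0%N)^°.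
have VP n : open (V n) /\ V n 1.
  elim: n => [|n [oV V1]] /=; first by split; [exact: open_interior|exact: W1].
  have [od d1 _] := hd _ (open_nbhs_nbhs (conj oV V1)).
  by split; [apply: openI => //; exact: open_interior|split => //; exact: W1].
exists V => [|[|n] x]; last 2 first.
- exact: interior_subset.
- by case=> _; exact: interior_subset.
split=> [n|n|n x y [dx _] [dy _]]; [exact: (VP n).1|exact: (VP n).2|].
by have [_ _] := hd _ (open_nbhs_nbhs (VP n)); apply.
Qed.

Section NestedNbhs.
Variable V : nat -> set G.
Hypothesis hV : nested_nbhs1 V.

Let V1 n : V n 1. Proof. by have [_ V1 _] := hV. Qed.

Let Vd n x y : V n.+1 x -> V n.+1 y -> V n (x^-1 * y).
Proof. by have [_ _] := hV; apply. Qed.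

Lemma nested_nbhs1S n : V n.+1 `<=` V n.
Proof. by move=> x Vx; rewrite -[x]mul1g -[1]invg1; exact: Vd. Qed.

Lemma nested_nbhs1_le m n : (m <= n)%N -> V n `<=` V m.
Proof.
move=> /subnK <-; elim: (n - m)%N => // k IH; rewrite addSn.
by move=> x /nested_nbhs1S/IH.
Qed.

(** Two levels are spent: one for inverting [x], one for dividing by the inverse. *)
Lemma nested_nbhs1M n x y : V n.+2 x -> V n.+2 y -> V n (x * y).
Proof.
move=> Vx Vy; rewrite -[x]invgK; apply: Vd; last exact: nested_nbhs1S.
by rewrite -[x^-1]mulg1; exact: Vd.
Qed.

Lemma closure_nested_nbhs1 n : closure (V n.+2) `<=` V n.
Proof.
move=> x clx.
have /clx[y [Vy Vyx]] : nbhs x [set y | V n.+2 (y^-1 * x)].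
  have : (fun y => y^-1 * x) @ x --> (1 : G).
    rewrite -[X in _ --> X](mulVg x); apply: mulg_cvg; last exact: cvg_cst.
    exact: invg_continuous.
  by apply; apply: open_nbhs_nbhs; split=> //; have [+ _ _] := hV; apply.
by rewrite -(mulVKg y x); exact: nested_nbhs1M.
Qed.

(** This allows compactness arguments, which need closed sets, to be run on the open sets [V n]. *)
Lemma bigcap_closure_nested_nbhs1 :
  \bigcap_n closure (V n) = \bigcap_n V n.
Proof.
rewrite eqEsubset; split=> x Vx n _; last exact/subset_closure/Vx.
exact/closure_nested_nbhs1/Vx.
Qed.

Lemma nested_nbhs1_subgroup : subgroup_set (\bigcap_n V n).
Proof. by split=> [n _|x y Vx Vy n _] //; apply: Vd; [exact: Vx|exact: Vy]. Qed.

Lemma closed_nested_nbhs1 : closed (\bigcap_n V n).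
Proof.
rewrite -bigcap_closure_nested_nbhs1; apply: closed_bigI => n _.
exact: closed_closure.
Qed.

End NestedNbhs.

(** * Convergent systems of cosets in a compact group *)

Section CosetSystem.
Hypothesis cG : compact [set: G].
Variable Phi : set_system nat.
Context {FPhi : Filter Phi}.

(* A closed subgroup [F None] together with left cosets [F (Some n)] of it
   that converge along [Phi] to the point [F None] of the coset space. *)
Definition coset_system (F : option nat -> set G) :=
  [/\ forall i, closed (F i), forall i, F i !=set0, F None 1,
      forall i x y, F i x -> (F i y <-> F None (x^-1 * y)) &
      forall W, open W -> F None `<=` W ->
        \forall n \near Phi, F (Some n) `<=` W].

Lemma coset_system_setT : coset_system (fun=> setT).
Proof.
split=> //= [i|W _ TW]; first by exists 1.
by apply: nearW.
Qed.

Lemma coset_system_subgroup F : coset_system F -> subgroup_set (F None).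
Proof. by case=> _ _ F1 cosF _; split=> // x y Fx Fy; apply/(cosF None _ y Fx). Qed.

Lemma coset_system_refine F (V : nat -> set G) (z : option nat -> G) :
  coset_system F -> nested_nbhs1 V -> z None = 1 -> (forall i, F i (z i)) ->
  (forall m, \forall n \near Phi, V m (z (Some n))) ->
  coset_system
    (fun i => [set y | (F None `&` \bigcap_n V n) ((z i)^-1 * y)]).
Proof.
move=> sF hV z1 Fz zV; have [clF F0 F1 cosF cvgF] := sF.
set K := F None `&` _.
have [K1 KV] : subgroup_set K.
  have [N1 NV] := coset_system_subgroup sF.
  have [M1 MV] := nested_nbhs1_subgroup hV.
  by split=> // x y [Nx Mx] [Ny My]; split; [exact: NV|exact: MV].
split=> [i|i||i x y /= Kx|W oW].
- apply: preimage_closed => [y _|]; first exact: mulg_continuousl.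
  by apply: closedI; [exact: clF|exact: closed_nested_nbhs1].
- by exists (z i); rewrite /= mulVg.
- by rewrite /= z1 mulVg.
- have zxy : (z i)^-1 * y = (z i)^-1 * x * (x^-1 * y).
    by rewrite -mulgA mulVKg.
  rewrite z1 invg1 mul1g; split=> [Ky|Kxy].
    by have := KV _ _ Kx Ky; rewrite invgM invgK -mulgA mulVKg.
  by rewrite zxy; exact: subgroup_setM.
- move=> KW.
  (* The closures intersect in the same set as the [V n], and the part of it inside [F None] is [K],
     which lies in [W]; by compactness a single closure suffices. *)
  have [m _ hm] : exists2 m, [set: nat] m &
      closure (V m) `<=` W `|` ~` F None.
    apply: compact_chain_sub => //.
    + by move=> m _; exact: closed_closure.
    + move=> m n _ _; have [mn|nm] := leqP m n.
        by right; apply: closureS; exact: nested_nbhs1_le.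
      by left; apply: closureS; apply: nested_nbhs1_le => //; exact: ltnW.
    + by apply: openU => //; exact/closed_openC/clF.
    + rewrite bigcap_closure_nested_nbhs1// => x Vx.
      have [Nx|] := pselect (F None x); last by right.
      by left; apply: KW; rewrite /= z1 invg1 mul1g.
  have FA : F None `<=` W `|` ~` closure (V m).
    move=> x Nx; have [/hm[|]//|] := pselect (closure (V m) x); first by left.
    by right.
  have oA : open (W `|` ~` closure (V m)).
    by apply: openU => //; apply: closed_openC; exact: closed_closure.
  (* Both [z (Some n)] and its quotient into [y] lie in [V m.+2], so [y] lies in [V m]; this
     excludes the second alternative of the open set above and leaves [W]. *)
  apply: filterS2 (cvgF _ oA FA) (zV m.+2) => n FnA Vzn y [Ny My].
  have : F (Some n) y by apply/(cosF _ _ _ (Fz (Some n))).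
  move=> /FnA[//|]; case; apply: subset_closure; rewrite -(mulVKg (z (Some n)) y).
  by apply: nested_nbhs1M => //; exact: My.
Qed.

Hypothesis Phi_oo : Phi --> \oo.

(** This is where openness of the quotient map enters: for each [m], the coset [F (Some n)]
    eventually meets [V m]. A diagonal choice then serves all [m] with one sequence. *)
Lemma coset_system_select F (V : nat -> set G) : coset_system F -> nested_nbhs1 V ->
  exists z : option nat -> G, [/\ z None = 1, forall i, F i (z i) &
    forall m, \forall n \near Phi, V m (z (Some n))].
Proof.
move=> sF hV; have [clF F0 F1 cosF cvgF] := sF.
(* As the [V m] decrease, a point in the smallest one met by the coset, among indices up to [M],
   works for all of them. *)
have sel n M : exists x, F (Some n) x /\ forall m, (m <= M)%N ->
    F (Some n) `&` V m !=set0 -> V m x.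
  elim: M => [|M [x [Fx xV]]].
    have [[x [Fx Vx]]|nV] := pselect (F (Some n) `&` V 0%N !=set0).
      by exists x; split=> // m; rewrite leqn0 => /eqP ->.
    have [x Fx] := F0 (Some n); exists x; split=> // m.
    by rewrite leqn0 => /eqP ->.
  have [[y [Fy Vy]]|nV] := pselect (F (Some n) `&` V M.+1 !=set0).
    by exists y; split=> // m mM _; exact: nested_nbhs1_le Vy.
  exists x; split=> // m; rewrite leq_eqVlt => /predU1P[-> //|].
  exact: xV.
have /choice[z hz] n := sel n n.
exists (fun i => if i is Some n then z n else 1); split=> // [[n|]|m] //.
  by have [] := hz n.
have [N1 NV] := coset_system_subgroup sF.
(* This is the product of [V m] with the subgroup [F None], an open set saturated under right
   translation by [F None]. *)
pose W := \bigcup_(x in F None) [set y | V m (y * x)].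
have oW : open W.
  apply: bigcup_open => x _; apply: open_comp => [y _|].
    exact: mulg_continuousr.
  by have [+ _ _] := hV; apply.
have NW : F None `<=` W.
  move=> x Nx; exists x^-1; first exact: subgroup_setV.
  by rewrite /= mulgV; have [_ + _] := hV; apply.
have mPhi : \forall n \near Phi, (m <= n)%N by apply: Phi_oo; exists m.
apply: filterS2 (cvgF _ oW NW) mPhi => n FW mn.
have [Fz zV] := hz n; apply: zV => //.
have [x Nx Vx] := FW _ Fz; exists (z n * x); split=> //.
by apply/(cosF _ _ _ Fz); rewrite mulKg.
Qed.

Lemma coset_system_bigcap (I : Type) (A : set I) (F : I -> option nat -> set G) :
  A !=set0 -> (forall s, A s -> coset_system (F s)) ->
  total_on A (fun s t => forall i, F s i `<=` F t i) ->
  coset_system (fun i => \bigcap_(s in A) F s i).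
Proof.
move=> A0 sF totF.
have sub i W : open W -> \bigcap_(s in A) F s i `<=` W ->
    exists2 s, A s & F s i `<=` W.
  apply: compact_chain_sub => //.
    by move=> s /sF[].
  by move=> s t /totF st /st[] h; [left|right]; exact: h.
split.
- by move=> i; apply: closed_bigI => s /sF[].
- move=> i; apply: contrapT => /set0P/negP/negPn/eqP F0.
  (* Nonemptiness is the compactness argument applied to the empty open set. *)
  have [s As Fs0] : exists2 s, A s & F s i `<=` set0.
    by apply: sub; [exact: open0|rewrite F0].
  by have [_ /(_ i)[x /Fs0]] := sF _ As.
- by move=> s /sF[].
- move=> i x y Fx; split=> Fy s As; have [_ _ _ cosF _] := sF _ As.
    by apply/(cosF i); [exact: Fx|exact: Fy].
  by apply/(cosF i _ _ (Fx s As)); exact: Fy.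
- move=> W oW /(sub _ _ oW)[s As FW]; have [_ _ _ _ cvgF] := sF _ As.
  by apply: filterS (cvgF _ oW FW) => n FnW x Fx; apply: FnW; exact: Fx.
Qed.

Hypothesis hG : hausdorff_space G.

Lemma coset_system_lift F0 : coset_system F0 ->
  exists2 x : nat -> G, (forall n, F0 (Some n) (x n)) & x @ Phi --> (1 : G).
Proof.
move=> sF0.
pose T := {F | coset_system F /\ forall i, F i `<=` F0 i}.
(* The order is reversed inclusion, so a Zorn-maximal element is a minimal system. *)
pose R (s t : T) := `[< forall i, sval t i `<=` sval s i >].
pose mk F sF FF0 : T := exist _ F (conj sF FF0).
have RP s t : reflect (forall i, sval t i `<=` sval s i) (R s t).
  exact: asboolP.
have [||||s smax] := @Zorn T R.
- by move=> t; apply/RP => i x.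
- move=> r s t /RP rs /RP st; apply/RP => i x.
  by move=> /st/rs.
- move=> [s hs] [t ht] /RP/= st /RP/= ts; apply: eq_exist => /=.
  by apply/funext => i; rewrite eqEsubset.
- move=> A totA; have [A0|/set0P/negP/negPn/eqP A0] := pselect (A !=set0);
    last first.
    by exists (mk F0 sF0 (fun=> @subset_refl _ _)) => s; rewrite A0.
  have sF : coset_system (fun i => \bigcap_(s in A) sval s i).
    apply: coset_system_bigcap => // [[s []]//|s t As At].
    by have [/RP st|/RP ts] := totA s t As At; [right|left].
  have F0s i : \bigcap_(s in A) sval s i `<=` F0 i.
    have [s As] := A0; move=> x /(_ s As); exact: (svalP s).2.
  exists (mk _ sF F0s) => s As; apply/RP => i x /=.
  exact.
- have [sF FF0] := svalP s; set F := sval s in sF FF0.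
  have N1 : F None `<=` [set 1].
    move=> p Np; apply: contrapT => p1.
    (* A point [p] other than 1 is separated from 1 by an open [A]; refining along a nested sequence
       inside [A] removes [p] from the subgroup, against minimality. *)
    have [|A [oA]] := hausdorff_accessible hG (x := 1) (y := p).
      by apply/eqP => /esym.
    rewrite !inE => A1 Ap.
    have [|V hV VA] := nested_nbhs1_exists (W := fun=> A).
      by move=> _; exact: open_nbhs_nbhs.
    have [z [z1 Fz zV]] := coset_system_select sF hV.
    have sF' := coset_system_refine sF hV z1 Fz zV.
    set F' := (fun i => _) in sF'.
    have F'F i : F' i `<=` F i.
      have [_ _ _ cosF _] := sF.
      by move=> y [Ny _]; apply/(cosF i _ _ (Fz i)).
    have F'F0 i : F' i `<=` F0 i by move=> y /F'F/FF0.
    have /(congr1 sval)/= eF : mk F' sF' F'F0 = s.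
      by apply: smax; apply/RP.
    have : F' None p by rewrite eF.
    by rewrite /F' /= z1 invg1 mul1g => -[_ /(_ 0%N I)/VA].
  have [_ Fn0 _ _ cvgF] := sF.
  have /choice[x Fx] n := Fn0 (Some n).
  exists x => [n|]; first exact/FF0/Fx.
  move=> W; rewrite nbhsE => -[U [oU U1] UW].
  have /(cvgF _ oU) : F None `<=` U by move=> y /N1 ->.
  by apply: filterS => n FU; exact/UW/FU.
Qed.

End CosetSystem.
End TopologicalGroup.

(** * Compact topological groups *)

Lemma compact_group_selectively_sequentially_pseudocompact
    (G : topologicalGroupType) :
  hausdorff_space G -> compact [set: G] ->
  selectively_sequentially_pseudocompact G.
Proof.
move=> hG cG U oU U0.
have /choice[g Ug] := U0.
have [n|V hV VU] := @nested_nbhs1_exists G (fun n => [set u | U n (g n * u)%g]).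
  apply: open_nbhs_nbhs; split; last by rewrite /= mulg1.
  by apply: open_comp (oU n) => y _; exact: mulg_continuousl.
have [|p [_ clp]] := cG (g @ \oo) _; first exact: filterT.
have [|k kS Vk] := @strictly_increasing_selection
    (fun m n => V m (p^-1 * g n)%g).
  move=> m N.
  have Vp : nbhs p [set y | V m (p^-1 * y)%g].
    have [oV V1 _] := hV.
    apply: open_nbhs_nbhs; split; last by rewrite /= mulVg.
    by apply: open_comp (oV m) => y _; exact: mulg_continuousl.
  have gN : (g @ \oo) [set g n | n in [set n | (N <= n)%N]].
    by exists N => // n Nn; exists n.
  by have [_ [[n Nn <-] Vn]] := clp _ _ gN Vp; exists n.
(* Translating by a cluster point [p] moves the limit to 1. Indices are not renumbered: convergence
   is taken along [k @ \oo], so the lifting still selects a point for every [n]. *)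
pose z i := if i is Some n then (p^-1 * g n)%g else 1%g.
have kV m : \forall n \near k @ \oo, V m (z (Some n)).
  exists m => // j /= mj; exact: nested_nbhs1_le mj _ (Vk j).
have kF : Filter (k @ \oo) by exact: fmap_filter.
(* Refining the trivial system, whose subgroup is all of [G], yields the cosets of the intersection
   of the [V n] through the points [z (Some n)]. *)
have /(_ kF) sF := coset_system_refine cG (@coset_system_setT _ _ kF) hV
  (erefl : z None = 1%g) (fun=> I) kV.
have [x Fx x1] := coset_system_lift cG (increasing_seq_cvg kS) hG sF.
exists (fun n => p * x n)%g => [n|].
  have [_ /(_ n I)/VU /=] := Fx n.
  by rewrite invgM invgK -mulgA mulVKg.
exists k, p; split=> //; rewrite -[X in _ --> X]mulg1.
by apply: mulg_cvg; [exact: cvg_cst|exact: x1].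
Qed.

(** * The Cantor cube as a compact group *)

(** A separate name to carry the group structure of pointwise exclusive or, in which every element
    is its own inverse. *)
Definition cantor_cube (I : Type) : Type := {ptws I -> bool}.

Section CantorGroup.
Variable I : Type.
Implicit Types f g h : cantor_cube I.

HB.instance Definition _ := Topological.copy (cantor_cube I) {ptws I -> bool}.

Let cmul f g : cantor_cube I := fun i => f i (+) g i.
Let cone : cantor_cube I := fun=> false.

Let cmulA : associative cmul.
Proof. by move=> f g h; apply/funext => i; exact: addbA. Qed.

Let cmul1 : left_id cone cmul.
Proof. by move=> f; apply/funext. Qed.

Let cmul1r : right_id cone cmul.
Proof. by move=> f; apply/funext => i; exact: addbF. Qed.

Let cmulV : left_inverse cone id cmul.
Proof. by move=> f; apply/funext => i; exact: addbb. Qed.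

Let cmulVr : right_inverse cone id cmul.
Proof. by move=> f; apply/funext => i; exact: addbb. Qed.

HB.instance Definition _ := monoid.isGroup.Build (cantor_cube I)
  cmulA cmul1 cmul1r cmulV cmulVr.

Lemma cantor_cube_cvgP (T : Type) (Phi : set_system T) (f : T -> cantor_cube I)
    (l : cantor_cube I) : Filter Phi ->
  f @ Phi --> l <-> forall i, \forall t \near Phi, f t i = l i.
Proof.
move=> FPhi; split=> [/cvg_sup fl i|fl].
  apply: (fl i [set g | g i = l i]).
  exists [set g | g i = l i]; split=> //.
  by exists [set l i]; [exact: discrete_open|].
apply/cvg_sup => i A [B [[C oC <-] Cl] CA].
by apply: filterS (fl i) => t ft; apply: CA; rewrite /= ft.
Qed.

Let cmul_continuous :
  continuous (fun x : cantor_cube I * cantor_cube I => (x.1 * x.2)%g).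
Proof.
move=> [f g]; apply/cantor_cube_cvgP => i /=.
have eval (h : cantor_cube I) : nbhs h [set h' | h' i = h i].
  by apply: (cantor_cube_cvgP id h (nbhs_filter h)).1; exact: cvg_id.
exists ([set h | h i = f i], [set h | h i = g i]); first by split; exact: eval.
by move=> [f' g'] [/= ff' gg']; congr (_ (+) _).
Qed.

Let cinv_continuous : continuous (fun x : cantor_cube I => x^-1%g).
Proof. by move=> f; exact: cvg_id. Qed.

HB.instance Definition _ := PreTopologicalGroup_isTopologicalGroup.Build
  (cantor_cube I) cmul_continuous cinv_continuous.

Lemma cantor_cube_hausdorff : hausdorff_space (cantor_cube I).
(* [{classic I}] gives the arbitrary type [I] classical equality and choice structures. *)
Proof. exact: (@hausdorff_product {classic I} _ (fun=> discrete_hausdorff)). Qed.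

Lemma cantor_cube_compact : compact [set: cantor_cube I].
Proof.
have := @tychonoff {classic I} _ _ (fun=> bool_compact).
by congr compact; apply/seteqP; split.
Qed.

End CantorGroup.

(** * Continuous images and dyadic spaces *)

Lemma continuous_image_selectively_sequentially_pseudocompact (X Y : topologicalType) (f : X -> Y) :
  continuous f -> range f = [set: Y] ->
  selectively_sequentially_pseudocompact X ->
  selectively_sequentially_pseudocompact Y.
Proof.
move=> cf fT sX U oU U0.
have [n|n|x Ux [k [l [kS xl]]]] := sX (fun n => f @^-1` U n).
- by apply: open_comp => // y _; exact: cf.
- have [y Uy] := U0 n; have : range f y by rewrite fT.
  by case=> x _ fx; exists x; rewrite /= fx.
- exists (f \o x) => //; exists k, (f l); split=> //.
  exact: cvg_comp xl (cf l).
Qed.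

Theorem corollary4p6 :
  (forall X : topologicalType,
     tychonoff_space X -> dyadic_space X ->
     selectively_sequentially_pseudocompact X) /\
  (forall G : topologicalGroupType,
     hausdorff_space G -> compact [set: G] ->
     selectively_sequentially_pseudocompact G).
Proof.
split=> [X _ [I [f [cf fT]]]|G].
  apply: (continuous_image_selectively_sequentially_pseudocompact cf fT).
  exact: (@compact_group_selectively_sequentially_pseudocompact (cantor_cube I)
    (@cantor_cube_hausdorff I) (@cantor_cube_compact I)).
exact: compact_group_selectively_sequentially_pseudocompact.
Qed.
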